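(* Let $L:\mathbb{R}^n\times\mathbb{R}^m\to\mathbb{R}\cup\{+\infty\}$ be of the form $L(x,y)=f(x)+Q(x,y)+g(y)$, where $f:\mathbb{R}^n\to\mathbb{R}\cup\{+\infty\}$ and $g:\mathbb{R}^m\to\mathbb{R}\cup\{+\infty\}$ are proper lower semicontinuous functions, $Q:\mathbb{R}^n\times\mathbb{R}^m\to\mathbb{R}$ is a $C^1$ function, and $\nabla Q$ is Lipschitz continuous on bounded subsets of $\mathbb{R}^n\times\mathbb{R}^m$. Let $(x_0,y_0)\in\mathbb{R}^n\times\mathbb{R}^m$. Assume that $\inf_{\mathbb{R}^n\times\mathbb{R}^m}L>-\infty$, that the function $L(\cdot,y_0)$ is proper, and that for some $0<r_-<r_+$ the stepsizes $\lambda_k,\mu_k$ belong to $(r_-,r_+)$ for all $k\ge 0$. Assume that $L$ has the Kurdyka-Łojasiewicz property at each point of $\operatorname{dom}\partial L$. Let $(x_k,y_k)_{k\ge 0}$ be a sequence starting from $(x_0,y_0)$ and generated by the alternating proximal minimization algorithm, i.e. for all $k\ge 0$ $$x_{k+1}\in\operatorname{argmin}\Big\{L(u,y_k)+\tfrac{1}{2\lambda_k}\|u-x_k\|^2:u\in\mathbb{R}^n\Big\},\qquad y_{k+1}\in\operatorname{argmin}\Big\{L(x_{k+1},v)+\tfrac{1}{2\mu_k}\|v-y_k\|^2:v\in\mathbb{R}^m\Big\}.$$ Then either $\|(x_k,y_k)\|$ tends to infinity, or $$\sum_{k=1}^{+\infty}\big(\|x_{k+1}-x_k\|+\|y_{k+1}-y_k\|\big)<+\infty$$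 and, as a consequence, $(x_k,y_k)$ converges to a critical point of $L$.
   Context: $\|\cdot\|$ is the Euclidean norm. For a proper lower semicontinuous $h:\mathbb{R}^N\to\mathbb{R}\cup\{+\infty\}$, $\operatorname{dom}h=\{x:h(x)<+\infty\}$. For $x\in\operatorname{dom}h$ the Fréchet subdifferential $\hat\partial h(x)$ is the set of $x^*$ with $\liminf_{y\to x,\,y\ne x}\frac{1}{\|x-y\|}[h(y)-h(x)-\langle x^*,y-x\rangle]\ge 0$. The (limiting) subdifferential of $h$ at $x\in\operatorname{dom}h$ is $\partial h(x)=\{x^*:\exists\,x_j\to x,\ h(x_j)\to h(x),\ x_j^*\in\hat\partial h(x_j),\ x_j^*\to x^*\}$, and both are empty for $x\notin\operatorname{dom}h$; $\operatorname{dom}\partial h=\{x:\partial h(x)\neq\emptyset\}$. A critical point of $h$ is a point $x$ with $0\in\partial h(x)$. $\operatorname{dist}(x,K)=\inf\{\|x-z\|:z\in K\}$, equal to $+\infty$ if $K=\emptyset$. The function $h$ has the Kurdyka-Łojasiewicz property at $\bar x\in\operatorname{dom}\partial h$ if there exist $\eta\in(0,+\infty]$, a neighborhood $U$ of $\bar x$ and a continuous concave function $\varphi:[0,\eta)\to\mathbb{R}_+$ such that $\varphi(0)=0$, $\varphi$ is $C^1$ on $(0,\eta)$, $\varphi'(s)>0$ for all $s\in(0,\eta)$, and for all $x\in U$ with $h(\bar x)<h(x)<h(\bar x)+\eta$ one has $\varphi'(h(x)-h(\bar x))\,\operatorname{dist}(0,\partial h(x))\ge 1$. *)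

(* Defs.v *)
(* R^N is 'rV[R]_N, and R^n x R^m is identified with
   R^(n+m) through row_mx. Functions with values in R U {+oo} are maps into
   \bar R; the value -oo is excluded by [proper_fun]. *)
From HB Require Import structures.
From mathcomp Require Import all_boot all_order all_algebra.
From mathcomp Require Import all_classical all_reals all_analysis.

Set Implicit Arguments.
Unset Strict Implicit.
Unset Printing Implicit Defensive.

Import Order.TTheory GRing.Theory Num.Theory.
Import numFieldNormedType.Exports.

Local Open Scope classical_set_scope.
Local Open Scope ring_scope.

Definition dotv (R : realType) (N : nat) (u v : 'rV[R]_N) : R :=
  \sum_(i < N) u 0 i * v 0 i.

(* The library norm `|u| on 'rV[R]_N is the sup norm, so the Euclidean norm is
   defined here; both induce the same topology and the same bounded sets, for
   which the library notions are used. *)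
Definition enorm (R : realType) (N : nat) (u : 'rV[R]_N) : R :=
  Num.sqrt (dotv u u).

Definition proper_fun (R : realType) (T : Type) (h : T -> \bar R) : Prop :=
  (forall x, (-oo < h x)%E) /\ (exists x, (h x < +oo)%E).

Definition edom (R : realType) (T : Type) (h : T -> \bar R) : set T :=
  [set x | (h x < +oo)%E].

Definition argmin (R : realType) (T : Type) (F : T -> \bar R) : set T :=
  [set u | forall v, (F u <= F v)%E].

Definition frechet_subdiff (R : realType) (N : nat) (h : 'rV[R]_N -> \bar R)
    (x : 'rV[R]_N) : set 'rV[R]_N :=
  [set v | edom h x /\
    (0 <= limf_einf (fun y : 'rV[R]_N =>
            (enorm (x - y))^-1%:E * (h y - h x - (dotv v (y - x))%:E))
          x^')%E].

Definition subdiff (R : realType) (N : nat) (h : 'rV[R]_N -> \bar R)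
    (x : 'rV[R]_N) : set 'rV[R]_N :=
  [set v | edom h x /\
    exists (xs vs : nat -> 'rV[R]_N),
      [/\ xs @ \oo --> x,
          (fun j => h (xs j)) @ \oo --> h x,
          forall j, frechet_subdiff h (xs j) (vs j) &
          vs @ \oo --> v]].

Definition dom_subdiff (R : realType) (N : nat) (h : 'rV[R]_N -> \bar R) :
  set 'rV[R]_N := [set x | subdiff h x !=set0].

Definition critical_point (R : realType) (N : nat) (h : 'rV[R]_N -> \bar R)
    (x : 'rV[R]_N) : Prop := subdiff h x 0.

(* ereal_inf set0 = +oo *)
Definition dist (R : realType) (N : nat) (x : 'rV[R]_N) (K : set 'rV[R]_N) :
  \bar R := ereal_inf [set (enorm (x - z))%:E | z in K].

(* phi is a total function, only constrained on [0, eta). *)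
Definition desingularizing (R : realType) (eta : \bar R) (phi : R -> R) : Prop :=
  let D : set R := [set s | 0 <= s /\ (s%:E < eta)%E] in
  [/\ (forall s, D s -> 0 <= phi s),
      {within D, continuous phi},
      @convex_function R R^o D (fun s => - phi s),
      phi 0 = 0 &
      forall s : R, 0 < s -> (s%:E < eta)%E ->
        [/\ derivable phi s 1, {for s, continuous (derive1 phi)} &
            0 < derive1 phi s]].

(* For h proper and xbar in dom_subdiff h, h xbar is finite, and so is h x in the
   last clause, also when eta = +oo: [fine] loses nothing. *)
Definition KL_property (R : realType) (N : nat) (h : 'rV[R]_N -> \bar R)
    (xbar : 'rV[R]_N) : Prop :=
  exists (eta : \bar R) (U : set 'rV[R]_N) (phi : R -> R),
    [/\ (0 < eta)%E, nbhs xbar U, desingularizing eta phi &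
        forall x, U x -> (h xbar < h x)%E -> (h x < h xbar + eta)%E ->
          (1 <= (derive1 phi (fine (h x - h xbar)))%:E * dist 0 (subdiff h x))%E].

Definition grad (R : realType) (N : nat) (Q : 'rV[R]_N -> R) (z : 'rV[R]_N) :
  'rV[R]_N := \row_(i < N) 'D_(delta_mx 0 i) Q z.

Definition C1 (R : realType) (N : nat) (Q : 'rV[R]_N -> R) : Prop :=
  (forall z, differentiable Q z) /\ continuous (grad Q).

Definition lipschitz_on_bounded (R : realType) (N : nat)
    (G : 'rV[R]_N -> 'rV[R]_N) : Prop :=
  forall B : set 'rV[R]_N, bounded_set B ->
    exists M : R, forall z w, B z -> B w ->
      enorm (G z - G w) <= M * enorm (z - w).

Definition alternating_proximal (R : realType) (n m : nat)
    (L : 'rV[R]_(n + m) -> \bar R) (lambda mu : nat -> R)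
    (x : nat -> 'rV[R]_n) (y : nat -> 'rV[R]_m) : Prop :=
  forall k : nat,
    argmin (fun u : 'rV[R]_n =>
      (L (row_mx u (y k)) + ((2 * lambda k)^-1 * enorm (u - x k) ^+ 2)%:E)%E)
      (x k.+1) /\
    argmin (fun v : 'rV[R]_m =>
      (L (row_mx (x k.+1) v) + ((2 * mu k)^-1 * enorm (v - y k) ^+ 2)%:E)%E)
      (y k.+1).

(* Main.v *)
Require Import Defs.
From HB Require Import structures.
From mathcomp Require Import all_boot all_order all_algebra.
From mathcomp Require Import all_classical all_reals all_analysis.
From mathcomp Require Import ring lra.

Set Implicit Arguments.
Unset Strict Implicit.
Unset Printing Implicit Defensive.

Import Order.TTheory GRing.Theory Num.Theory.
Import numFieldNormedType.Exports.
Local Open Scope classical_set_scope.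
Local Open Scope ring_scope.

(** Write [z k] for the pair of iterates and [d k] for the sum of the lengths of
    the two half-steps leading to the next pair.

    Testing each minimization with the previous iterate shows that the real
    numbers [L (z k)] decrease by at least a fixed multiple of [d k ^+ 2]
    ([value_descent]).  They are bounded below, hence converge, and [d] tends
    to 0 ([descent_increment_cvg0]).  The optimality conditions produce a
    subgradient of [L] at the new iterate: up to multiples of the steps it is
    the variation of the partial gradient of [Q] caused by the update of [y], so
    that the Lipschitz condition bounds its norm by [b * d k] near any given
    point ([iterate_subgradient]).

    If the norms do not tend to infinity, then the iterates have a cluster point
    [zbar] ([bounded_freq_cluster]).  Comparing the minimizers with the
    coordinates of [zbar] shows that [L zbar] is the limit of the values
    ([cluster_point_value]), and the subgradient bound then makes [zbar] a
    critical point ([cluster_point_critical]), so that the Kurdyka-Lojasiewicz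
    inequality is available there.

    The heart of the argument is [KL_finite_length].  Let [s k] be the gap
    between [L (z k)] and its limit.  By concavity of [phi],
    [phi (s k) - phi (s k.+1) >= phi' (s k) * (s k - s k.+1)]; the descent
    bounds the last factor below by a multiple of [d k ^+ 2], and the
    Kurdyka-Lojasiewicz inequality bounds [phi' (s k)] below by
    [(b * d k.-1)^-1].  The inequality of arithmetic and geometric means turns
    this into
      [2 * d k <= d k.-1 + C * (phi (s k) - phi (s k.+1))],
    whose sum telescopes, as long as the iterates stay in the neighborhood where
    the inequality holds.  Starting close enough to [zbar], the length bound
    itself keeps them there ([trapped_finite_length]).  Finite length and the
    cluster point together give convergence to [zbar] ([finite_length_cvg]). *)

(** * The Euclidean norm and the sup norm *)

Section EuclideanNorm.
Variable R : realType.

Lemma dotvC N (u v : 'rV[R]_N) : dotv u v = dotv v u.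
Proof. by apply: eq_bigr => i _; rewrite mulrC. Qed.

Lemma dotvv_ge0 N (u : 'rV[R]_N) : 0 <= dotv u u.
Proof. by apply: sumr_ge0 => i _; rewrite -expr2 sqr_ge0. Qed.

Lemma dotvDl N (u v w : 'rV[R]_N) : dotv (u + v) w = dotv u w + dotv v w.
Proof.
by rewrite /dotv -big_split; apply: eq_bigr => i _; rewrite !mxE mulrDl.
Qed.

Lemma dotvNl N (v w : 'rV[R]_N) : dotv (- v) w = - dotv v w.
Proof.
by rewrite /dotv -sumrN; apply: eq_bigr => i _; rewrite !mxE mulNr.
Qed.

Lemma dotvZl N (c : R) (v w : 'rV[R]_N) : dotv (c *: v) w = c * dotv v w.
Proof.
by rewrite /dotv mulr_sumr; apply: eq_bigr => i _; rewrite !mxE mulrA.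
Qed.

Lemma dotv0l N (v : 'rV[R]_N) : dotv 0 v = 0.
Proof. by rewrite /dotv big1// => i _; rewrite mxE mul0r. Qed.

Lemma dotv_row_mx n m (a c : 'rV[R]_n) (b d : 'rV[R]_m) :
  dotv (row_mx a b) (row_mx c d) = dotv a c + dotv b d.
Proof.
rewrite /dotv big_split_ord/=; congr (_ + _); apply: eq_bigr => i _.
  by rewrite !row_mxEl.
by rewrite !row_mxEr.
Qed.

Lemma enorm_ge0 N (u : 'rV[R]_N) : 0 <= enorm u.
Proof. exact: sqrtr_ge0. Qed.

Lemma enorm_sqr N (u : 'rV[R]_N) : enorm u ^+ 2 = dotv u u.
Proof. by rewrite sqr_sqrtr// dotvv_ge0. Qed.

Lemma enormN N (u : 'rV[R]_N) : enorm (- u) = enorm u.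
Proof.
by congr Num.sqrt; apply: eq_bigr => i _; rewrite !mxE mulrNN.
Qed.

Lemma enorm0 N : enorm (0 : 'rV[R]_N) = 0.
Proof.
by rewrite /enorm /dotv big1 ?sqrtr0// => i _; rewrite mxE mul0r.
Qed.

Lemma rV_norm_le N (u : 'rV[R]_N) (c : R) :
  0 <= c -> (forall i, `|u 0 i| <= c) -> `|u| <= c.
Proof.
move=> c0 uc; rewrite [leLHS]/Num.Def.normr/= mx_normrE (bigmax_le _ c0)//=.
by move=> [i j] _ /=; rewrite ord1.
Qed.

Lemma rV_coord_le N (u : 'rV[R]_N) i : `|u 0 i| <= `|u|.
Proof.
rewrite [leRHS]/Num.Def.normr/= mx_normrE.
exact: (le_bigmax _ (fun ij : 'I_1 * 'I_N => `|u ij.1 ij.2|) (0, i)).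
Qed.

Lemma norm_le_enorm N (u : 'rV[R]_N) : `|u| <= enorm u.
Proof.
apply: rV_norm_le (enorm_ge0 u) _ => i.
rewrite -sqrtr_sqr ler_wsqrtr// /dotv (bigD1 i)//= -expr2 lerDl.
by apply: sumr_ge0 => j _; rewrite -expr2 sqr_ge0.
Qed.

(** A crude constant ([Num.sqrt N%:R] is the sharp one), which suffices because
    only the equivalence of the two norms matters. *)
Lemma enorm_le_norm N (u : 'rV[R]_N) : enorm u <= N%:R * `|u|.
Proof.
rewrite -[leRHS]ger0_norm ?mulr_ge0// -sqrtr_sqr ler_wsqrtr//.
apply: (@le_trans _ _ (\sum_(i < N) `|u| ^+ 2)).
  apply: ler_sum => i _; rewrite -expr2 -real_normK ?num_real//.
  by rewrite lerXn2r ?nnegrE// rV_coord_le.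
rewrite sumr_const card_ord -[leLHS]mulr_natl [leRHS]exprMn ler_wpM2r ?sqr_ge0//.
by rewrite -natrX ler_nat; case: N {u} => // N; rewrite leq_pmulr.
Qed.

Lemma enorm_near N (z : 'rV[R]_N) (e : R) :
  0 < e -> \forall w \near z, enorm (w - z) <= e.
Proof.
move=> e0; have e1 : 0 < e / N.+1%:R by rewrite divr_gt0.
near=> w; apply: (le_trans (enorm_le_norm _)).
apply: (@le_trans _ _ (N.+1%:R * (e / N.+1%:R))); last by rewrite mulrC divfK.
by apply: ler_pM => //; rewrite ler_nat.
Unshelve. all: by end_near. Qed.

Lemma enorm_cvg0 N (u : nat -> 'rV[R]_N) (ubar : 'rV[R]_N) :
  u @ \oo --> ubar -> (fun j => enorm (ubar - u j)) @ \oo --> 0.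
Proof.
move=> uubar; apply/cvgrPdist_le => e e0; near=> j.
rewrite sub0r normrN ger0_norm ?enorm_ge0// -enormN opprB.
by near: j; exact: (uubar _ (enorm_near ubar e0)).
Unshelve. all: by end_near. Qed.

Lemma enorm_lsubmx n m (w : 'rV[R]_(n + m)) : enorm (lsubmx w) <= enorm w.
Proof.
rewrite ler_wsqrtr// -{3 4}[w]hsubmxK dotv_row_mx lerDl.
exact: dotvv_ge0.
Qed.

Lemma enorm_rsubmx n m (w : 'rV[R]_(n + m)) : enorm (rsubmx w) <= enorm w.
Proof.
rewrite ler_wsqrtr// -{3 4}[w]hsubmxK dotv_row_mx lerDr.
exact: dotvv_ge0.
Qed.

Lemma enorm_row0 n m (a : 'rV[R]_n) : enorm (row_mx a (0 : 'rV[R]_m)) = enorm a.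
Proof.
rewrite /enorm dotv_row_mx -[dotv 0 0]enorm_sqr enorm0.
by rewrite expr0n addr0.
Qed.

Lemma enorm_0row n m (b : 'rV[R]_m) : enorm (row_mx (0 : 'rV[R]_n) b) = enorm b.
Proof.
rewrite /enorm dotv_row_mx -[dotv 0 0]enorm_sqr enorm0.
by rewrite expr0n add0r.
Qed.

Lemma norm_row_mx_le n m (a : 'rV[R]_n) (b : 'rV[R]_m) (c : R) :
  `|a| <= c -> `|b| <= c -> `|row_mx a b| <= c.
Proof.
move=> ac bc; apply: rV_norm_le => [|i]; first exact: le_trans ac.
rewrite mxE; case: splitP => j _.
  exact: le_trans (rV_coord_le _ _) ac.
exact: le_trans (rV_coord_le _ _) bc.
Qed.

Lemma norm_lsubmx_le n m (w : 'rV[R]_(n + m)) : `|lsubmx w| <= `|w|.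
Proof. by apply: rV_norm_le => // i; rewrite mxE rV_coord_le. Qed.

Lemma norm_rsubmx_le n m (w : 'rV[R]_(n + m)) : `|rsubmx w| <= `|w|.
Proof. by apply: rV_norm_le => // i; rewrite mxE rV_coord_le. Qed.

Lemma cvg_row_mx T (F : set_system T) {FF : Filter F} n m
    (a : T -> 'rV[R]_n) (b : T -> 'rV[R]_m) (a0 : 'rV[R]_n) (b0 : 'rV[R]_m) :
  a @ F --> a0 -> b @ F --> b0 ->
  (fun t => row_mx (a t) (b t)) @ F --> row_mx a0 b0.
Proof.
move=> /cvgrPdist_le ha /cvgrPdist_le hb; apply/cvgrPdist_le => e e0.
near=> t; rewrite opp_row_mx add_row_mx norm_row_mx_le//; near: t.
- exact: ha.
- exact: hb.
Unshelve. all: by end_near. Qed.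

Lemma cvg_lsubmx T (F : set_system T) {FF : Filter F} n m
    (w : T -> 'rV[R]_(n + m)) (w0 : 'rV[R]_(n + m)) :
  w @ F --> w0 -> (fun t => lsubmx (w t)) @ F --> lsubmx w0.
Proof.
move=> /cvgrPdist_le hw; apply/cvgrPdist_le => e e0.
near=> t; rewrite -raddfB (le_trans (norm_lsubmx_le _))//; near: t.
exact: hw.
Unshelve. all: by end_near. Qed.

Lemma cvg_rsubmx T (F : set_system T) {FF : Filter F} n m
    (w : T -> 'rV[R]_(n + m)) (w0 : 'rV[R]_(n + m)) :
  w @ F --> w0 -> (fun t => rsubmx (w t)) @ F --> rsubmx w0.
Proof.
move=> /cvgrPdist_le hw; apply/cvgrPdist_le => e e0.
near=> t; rewrite -raddfB (le_trans (norm_rsubmx_le _))//; near: t.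
exact: hw.
Unshelve. all: by end_near. Qed.

End EuclideanNorm.

(** * Gradients and Frechet subgradients *)

Section Gradients.
Variable R : realType.

(** Frechet differentiability with the gradient given as a row vector and the
    remainder measured in the Euclidean norm, the form in which it enters the
    Frechet subdifferential. *)
Definition has_gradient N (S : 'rV[R]_N -> R) (z v : 'rV[R]_N) : Prop :=
  forall e : R, 0 < e -> \forall w \near z,
    `|S w - S z - dotv v (w - z)| <= e * enorm (w - z).

Lemma differentiable_has_gradient N (S : 'rV[R]_N -> R) (z : 'rV[R]_N) :
  differentiable S z -> has_gradient S z (grad S z).
Proof.
move=> dS e e0.
have dE h : 'd S z h = dotv (grad S z) h.
  rewrite {1}[h]row_sum_delta linear_sum/=; apply: eq_bigr => i _.
  by rewrite linearZ/= -deriveE// !mxE mulrC.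
have /eqaddoP/(_ _ e0) oS := diff_locally dS.
rewrite (near_shift 0); near=> h => /=.
have -> : S (h + (z - 0)) - S z - dotv (grad S z) (h + (z - 0) - z) =
  (S \o shift z - (cst (S z) + 'd S z)) h.
  by rewrite subr0 addrK -dE /= !fctE /cst opprD addrA.
rewrite subr0 addrK; apply: (@le_trans _ _ (e * `|h|)).
  by near: h.
by rewrite ler_wpM2l ?(ltW e0)// norm_le_enorm.
Unshelve. all: by end_near. Qed.

Lemma has_gradientD N (S T : 'rV[R]_N -> R) (z v w : 'rV[R]_N) :
  has_gradient S z v -> has_gradient T z w ->
  has_gradient (fun u => S u + T u) z (v + w).
Proof.
move=> gS gT e e0.
have e2 : 0 < e / 2 by rewrite divr_gt0.
near=> u; rewrite dotvDl.
have Su : `|S u - S z - dotv v (u - z)| <= e / 2 * enorm (u - z).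
  by near: u; exact: gS.
have Tu : `|T u - T z - dotv w (u - z)| <= e / 2 * enorm (u - z).
  by near: u; exact: gT.
by move: Su Tu; rewrite !ler_norml; lra.
Unshelve. all: by end_near. Qed.

Lemma has_gradientN N (S : 'rV[R]_N -> R) (z v : 'rV[R]_N) :
  has_gradient S z v -> has_gradient (fun u => - S u) z (- v).
Proof.
move=> gS e e0; apply: filterS (gS e e0) => w.
by rewrite -normrN dotvNl; congr (`|_| <= _); ring.
Qed.

Lemma has_gradientB N (S T : 'rV[R]_N -> R) (z v w : 'rV[R]_N) :
  has_gradient S z v -> has_gradient T z w ->
  has_gradient (fun u => S u - T u) z (v - w).
Proof. by move=> gS gT; apply: has_gradientD => //; exact: has_gradientN. Qed.

Lemma has_gradient_sqr_dist N (c : R) (a z : 'rV[R]_N) : 0 < c ->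
  has_gradient (fun u => c * enorm (u - a) ^+ 2) z ((2 * c) *: (z - a)).
Proof.
move=> c0 e e0; near=> u; rewrite dotvZl.
have -> : c * enorm (u - a) ^+ 2 - c * enorm (z - a) ^+ 2 -
    2 * c * dotv (z - a) (u - z) = c * enorm (u - z) ^+ 2.
  rewrite !enorm_sqr /dotv !mulr_sumr -!sumrB; apply: eq_bigr => i _.
  by rewrite !mxE; ring.
have h0 : 0 <= c * enorm (u - z) ^+ 2 by rewrite mulr_ge0 ?sqr_ge0// ltW.
rewrite (ger0_norm h0) expr2 mulrA.
rewrite ler_wpM2r ?enorm_ge0// mulrC -ler_pdivlMr//.
by near: u; apply: enorm_near; rewrite divr_gt0.
Unshelve. all: by end_near. Qed.

Lemma has_gradient_lsubmx n m (T : 'rV[R]_n -> R) (z : 'rV[R]_(n + m)) p :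
  has_gradient T (lsubmx z) p ->
  has_gradient (fun w => T (lsubmx w)) z (row_mx p 0).
Proof.
move=> gT e e0.
have : \forall w \near z, `|T (lsubmx w) - T (lsubmx z)
    - dotv p (lsubmx w - lsubmx z)| <= e * enorm (lsubmx w - lsubmx z).
  have cz : lsubmx w @[w --> z] --> lsubmx z.
    exact: (@cvg_lsubmx _ _ (nbhs z) _ _ _ idfun z cvg_id).
  exact: (cz _ (gT e e0)).
apply: filterS => w.
rewrite -raddfB -{3}[w - z]hsubmxK dotv_row_mx dotv0l addr0 => /le_trans.
by apply; rewrite ler_wpM2l ?(ltW e0)// enorm_lsubmx.
Qed.

Lemma has_gradient_rsubmx n m (T : 'rV[R]_m -> R) (z : 'rV[R]_(n + m)) p :
  has_gradient T (rsubmx z) p ->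
  has_gradient (fun w => T (rsubmx w)) z (row_mx 0 p).
Proof.
move=> gT e e0.
have : \forall w \near z, `|T (rsubmx w) - T (rsubmx z)
    - dotv p (rsubmx w - rsubmx z)| <= e * enorm (rsubmx w - rsubmx z).
  have cz : rsubmx w @[w --> z] --> rsubmx z.
    exact: (@cvg_rsubmx _ _ (nbhs z) _ _ _ idfun z cvg_id).
  exact: (cz _ (gT e e0)).
apply: filterS => w.
rewrite -raddfB -{3}[w - z]hsubmxK dotv_row_mx dotv0l add0r => /le_trans.
by apply; rewrite ler_wpM2l ?(ltW e0)// enorm_rsubmx.
Qed.

Lemma has_gradient_slicel n m (S : 'rV[R]_(n + m) -> R)
    (a : 'rV[R]_n) (b : 'rV[R]_m) v :
  has_gradient S (row_mx a b) v ->
  has_gradient (fun u => S (row_mx u b)) a (lsubmx v).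
Proof.
move=> gS e e0.
have cz : row_mx (idfun u) b @[u --> a] --> row_mx a b.
  exact: (@cvg_row_mx _ _ (nbhs a) _ _ _ idfun (cst b) a b cvg_id (cvg_cst b)).
apply: (filterS _ (cz _ (gS e e0) : nbhs a _)) => u /=.
rewrite opp_row_mx add_row_mx subrr enorm_row0 -{1}[v]hsubmxK.
by rewrite dotv_row_mx [dotv (rsubmx v) 0]dotvC dotv0l addr0.
Qed.

Lemma has_gradient_slicer n m (S : 'rV[R]_(n + m) -> R)
    (a : 'rV[R]_n) (b : 'rV[R]_m) v :
  has_gradient S (row_mx a b) v ->
  has_gradient (fun u => S (row_mx a u)) b (rsubmx v).
Proof.
move=> gS e e0.
have cz : row_mx a (idfun u) @[u --> b] --> row_mx a b.
  exact: (@cvg_row_mx _ _ (nbhs b) _ _ _ (cst a) idfun a b (cvg_cst a) cvg_id).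
apply: (filterS _ (cz _ (gS e e0) : nbhs b _)) => u /=.
rewrite opp_row_mx add_row_mx subrr enorm_0row -{1}[v]hsubmxK.
by rewrite dotv_row_mx [dotv (lsubmx v) 0]dotvC dotv0l add0r.
Qed.

(** Fermat's rule: if [h - S] is minimal at [z], then the first-order expansion
    of [S] minorizes that of [h]. *)
Lemma frechet_subdiff_touching N (h : 'rV[R]_N -> \bar R) (S : 'rV[R]_N -> R)
    (z v : 'rV[R]_N) :
  h z \is a fin_num -> has_gradient S z v ->
  (forall w, h z + (S w - S z)%:E <= h w)%E -> frechet_subdiff h z v.
Proof.
move=> hz gS hS; split; first by rewrite /edom/= ltey_eq hz.
rewrite limf_einfE; apply/lee_subgt0Pr => e e0; rewrite sub0e.
pose V := [set w | w != z /\
  `|S w - S z - dotv v (w - z)| <= e * enorm (w - z)].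
have zV : z^' V.
  near=> w; split; first by near: w; exact: nbhs_dnbhs_neq.
  by near: w; apply: nbhs_dnbhs; exact: gS.
apply: (@le_trans _ _ (ereal_inf [set (enorm (z - w))^-1%:E *
    (h w - h z - (dotv v (w - z))%:E) | w in V])%E); last first.
  by apply: ereal_sup_ubound; exists V.
apply: le_ereal_inf_tmp => _ [w [wz Sw] <-].
have r0 : 0 < enorm (z - w).
  by apply: lt_le_trans (norm_le_enorm _); rewrite normr_gt0 subr_eq0 eq_sym.
rewrite -(enormN (w - z)) opprB in Sw.
have := hS w; case: (h z) hz => // a _; case: (h w) => [b| |] //; last first.
  by move=> _; rewrite addye// gt0_muley ?lte_fin ?invr_gt0// leey.
rewrite -!EFinD !lee_fin -ler_pdivrMl ?invr_gt0// invrK => aSb.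
by move: Sw; rewrite ler_norml => /andP[]; lra.
Unshelve. all: by end_near. Qed.

Lemma frechet_subdiff_sub N (h : 'rV[R]_N -> \bar R) (z v : 'rV[R]_N) :
  frechet_subdiff h z v -> subdiff h z v.
Proof.
move=> hv; split; first exact: hv.1.
by exists (fun=> z), (fun=> v); split=> //; exact: cvg_cst.
Qed.

End Gradients.

(** * Sequences: cluster points, finite length, lower semicontinuity *)

Section Sequences.
Variable R : realType.

Lemma cluster_seqP (V : normedModType R) (z : nat -> V) (zbar : V) :
  cluster (z @ \oo) zbar <->
  forall e, 0 < e -> forall K, exists2 k, (K <= k)%N & `|z k - zbar| < e.
Proof.
split=> [zP e e0 K|freq A B [K _ KA] /nbhs_ballP[e /= e0 eB]].
  have FK : (z @ \oo) (z @` [set k | (K <= k)%N]).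
    by exists K => // k Kk; exists k.
  have [u [[k Kk <-] ue]] := zP _ _ FK (nbhsx_ballx zbar e e0).
  by exists k => //; move: ue; rewrite -ball_normE /= distrC.
have [k Kk zk] := freq e e0 K.
exists (z k); split; first exact: KA.
by apply: eB; rewrite -ball_normE /= distrC.
Qed.

(** The subsequence is delayed by one index so that both ends of the steps that
    it selects approach the cluster point. *)
Lemma cluster_subsequence (V : normedModType R) (z : nat -> V) (zbar : V)
    (d : nat -> R) :
  cluster (z @ \oo) zbar -> (forall k, `|z k.+1 - z k| <= d k) ->
  d @ \oo --> 0 ->
  exists s : nat -> nat, [/\ s @ \oo --> \oo,
    (fun j => z (s j)) @ \oo --> zbar & (fun j => z (s j).+1) @ \oo --> zbar].
Proof.
move=> /cluster_seqP freq zd dcvg.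
have /choice[s sP] : forall j, exists k,
    (j <= k)%N /\ `|z k.+1 - zbar| < j.+1%:R^-1.
  move=> j; have [|[//|k] jk zk] := freq j.+1%:R^-1 _ j.+1.
    by rewrite invr_gt0.
  by exists k.
have s_oo : s @ \oo --> \oo.
  move=> B [K _ KB]; exists K => // j /= Kj; apply: KB => /=.
  exact: leq_trans Kj (sP j).1.
have zs1 : (fun j => z (s j).+1) @ \oo --> zbar.
  apply/cvgrPdist_lt => e e0; near=> j; rewrite distrC.
  apply: lt_trans (sP j).2 _.
  by near: j; exact: (near_infty_natSinv_lt (PosNum e0)).
have ds : (fun j => d (s j)) @ \oo --> 0 by exact: (cvg_comp _ _ s_oo dcvg).
exists s; split=> //.
apply/cvgrPdist_le => e e0.
have e2 : 0 < e / 2 by rewrite divr_gt0.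
near=> j.
have -> : zbar - z (s j) = (zbar - z (s j).+1) + (z (s j).+1 - z (s j)).
  by rewrite subrKA.
apply: (le_trans (ler_normD _ _)); rewrite (splitr e) lerD//.
  by near: j; move/cvgrPdist_le : zs1; exact.
apply: (le_trans (zd _)); near: j.
exact: (cvgr_le _ ds).
Unshelve. all: by end_near. Qed.

(** The tails of the length series bound the distances between late terms, and
    the cluster point identifies the limit. *)
Lemma finite_length_cvg (V : normedModType R) (z : nat -> V) (zbar : V)
    (d : nat -> R) (C : R) :
  (forall k, `|z k.+1 - z k| <= d k) ->
  (forall n, \sum_(k < n) d k <= C) ->
  cluster (z @ \oo) zbar -> z @ \oo --> zbar.
Proof.
move=> zd dC /cluster_seqP freq.
have d0 k : 0 <= d k by exact: le_trans (zd k).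
pose S n := \sum_(k < n) d k.
have Snd : nondecreasing_seq S.
  by apply/nondecreasing_seqP => n; rewrite /S big_ord_recr/= lerDl.
have Scvg : cvgn S.
  apply: nondecreasing_is_cvgn => //; exists C => _ [n _ <-]; exact: dC.
have Sle := nondecreasing_cvgn_le Snd Scvg.
have zS n p : `|z (n + p)%N - z n| <= S (n + p)%N - S n.
  elim: p => [|p IH]; first by rewrite addn0 !subrr normr0.
  rewrite addnS {1}/S big_ord_recr/= -/(S _).
  have -> : z (n + p).+1 - z n = (z (n + p).+1 - z (n + p)%N) +
    (z (n + p)%N - z n) by rewrite subrKA.
  apply: (le_trans (ler_normD _ _)).
  by have := zd (n + p)%N; move: IH; lra.
apply/cvgrPdist_lt => e e0.
have e2 : 0 < e / 2 by rewrite divr_gt0.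
have [K _ SK] : \forall k \near \oo, limn S - e / 2 < S k.
  by apply: (cvgr_gt _ Scvg); rewrite ltrBlDr ltrDl.
have [k Kk zk] := freq _ e2 K.
exists k => // n /= kn; rewrite distrC.
have -> : z n - zbar = (z n - z k) + (z k - zbar) by rewrite subrKA.
apply: (le_lt_trans (ler_normD _ _)).
have := zS k (n - k)%N; rewrite subnKC// => znk.
by have := SK k Kk; have := Sle n => /=; lra.
Qed.

Lemma not_cvg_pinfty_freq (u : nat -> R) : ~ (u @ \oo --> +oo) ->
  exists A, forall K, exists2 k, (K <= k)%N & u k < A.
Proof.
move=> uoo; apply: contrapT => /forallNP uA; apply: uoo.
apply/cvgryPge => A.
have [K uK] : exists K, forall k, (K <= k)%N -> A <= u k.
  apply: contrapT => /forallNP KA; apply: (uA A) => K.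
  apply: contrapT => Kk; apply: (KA K) => k Kk'.
  by rewrite leNgt; apply/negP => ukA; apply: Kk; exists k.
by exists K.
Qed.

(** Compactness of the closed balls, applied to the subsequence of bounded
    terms. *)
Lemma bounded_freq_cluster N (w : nat -> 'rV[R]_N) (A : R) :
  (forall K, exists2 k, (K <= k)%N & `|w k| <= A) ->
  exists zbar, cluster (w @ \oo) zbar.
Proof.
move=> wA.
have /choice[t tP] : forall K, exists k, (K <= k)%N /\ `|w k| <= A.
  by move=> K; have [k] := wA K; exists k.
have Bcompact : compact [set u : 'rV[R]_N | `|u| <= A].
  apply: bounded_closed_compact.
    exists A; split; first exact: num_real.
    by move=> M /ltW AM u /= /le_trans; apply.
  apply: (@closed_comp _ _ (fun u : 'rV[R]_N => `|u|) [set x | x <= A]).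
    by move=> u _; exact: norm_continuous.
  exact: closed_le.
have FB : ((w \o t) @ \oo) [set u : 'rV[R]_N | `|u| <= A].
  by exists 0%N => // k _ /=; exact: (tP k).2.
have [zbar [_ /cluster_seqP zP]] := Bcompact _ _ FB.
exists zbar; apply/cluster_seqP => e e0 K.
have [k Kk zk] := zP e e0 K.
by exists (t k) => //; exact: leq_trans (tP k).1.
Qed.

(** Lower semicontinuity supplies the missing lower bound. *)
Lemma lsc_limsup_cvg (T : topologicalType) (f : T -> \bar R)
    (u : nat -> T) (ubar : T) (a : R) (fu c : nat -> R) :
  lower_semicontinuous f -> u @ \oo --> ubar ->
  f ubar = a%:E -> (forall j, f (u j) = (fu j)%:E) ->
  (forall j, fu j <= a + c j) -> c @ \oo --> 0 -> fu @ \oo --> a.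
Proof.
move=> lscf uubar fubar fuE fuc c0; apply/cvgrPdist_le => e e0.
have [|V Vubar Vf] := lscf ubar (a - e).
  by rewrite fubar lte_fin ltrBlDr ltrDl.
near=> j; rewrite ler_distlC.
have Vuj : V (u j) by near: j; exact: (uubar _ Vubar).
have cj : c j <= e by near: j; exact: (cvgr_le _ c0).
have /= := Vf _ Vuj; rewrite fuE lte_fin => afu.
by have := fuc j; lra.
Unshelve. all: by end_near. Qed.

(** If [f ubar] were [+oo], then [fu] would tend to [+oo] while [gv] stays bounded
    below, against the bound on the sums. *)
Lemma lsc_sum_bounded_fin (T1 T2 : topologicalType) (f : T1 -> \bar R)
    (g : T2 -> \bar R) (u : nat -> T1) (v : nat -> T2) (ubar : T1) (vbar : T2)
    (fu gv : nat -> R) (M : R) :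
  lower_semicontinuous f -> lower_semicontinuous g ->
  u @ \oo --> ubar -> v @ \oo --> vbar ->
  (forall j, f (u j) = (fu j)%:E) -> (forall j, g (v j) = (gv j)%:E) ->
  (-oo < f ubar)%E -> (-oo < g vbar)%E ->
  (\forall j \near \oo, fu j + gv j <= M) -> f ubar \is a fin_num.
Proof.
move=> lscf lscg uubar vvbar fuE gvE fubar gvbar fgM.
rewrite fin_numE gt_eqF//=; apply/eqP => fubary.
have [b gb] : exists b : R, (b%:E < g vbar)%E.
  case: (g vbar) gvbar => [s| |] // _; last by exists 0; rewrite ltry.
  by exists (s - 1); rewrite lte_fin ltrBlDr ltrDl.
have [V Vubar Vf] := lscf ubar (M - b) (eq_ind_r (fun a => _ < a)%E (ltry _) fubary).
have [W Wvbar Wg] := lscg vbar b gb.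
have [j [[Vj Wj] Mj]] : exists j, (V (u j) /\ W (v j)) /\ fu j + gv j <= M.
  apply: (@filter_ex _ \oo).
  near=> j; split; last by near: j.
  split; near: j; first exact: (uubar _ Vubar).
  exact: (vvbar _ Wvbar).
have := Vf _ Vj; have := Wg _ Wj; rewrite fuE gvE !lte_fin; lra.
Unshelve. all: by end_near. Qed.

(** Comparing the proximal minimizer [u j] with the limit [ub] itself bounds
    [limsup hu] by [h ub]; lower semicontinuity gives the other inequality. *)
Lemma prox_value_cvg N (h : 'rV[R]_N -> \bar R) (p u : nat -> 'rV[R]_N)
    (ub : 'rV[R]_N) (hu q qb tau : nat -> R) (l rm : R) :
  lower_semicontinuous h -> p @ \oo --> ub -> u @ \oo --> ub ->
  h ub \is a fin_num -> (forall j, h (u j) = (hu j)%:E) ->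
  q @ \oo --> l -> qb @ \oo --> l -> 0 < rm -> (forall j, rm < tau j) ->
  (forall j, ((hu j + (q j + (2 * tau j)^-1 * enorm (u j - p j) ^+ 2))%:E
    <= h ub + (qb j + (2 * tau j)^-1 * enorm (ub - p j) ^+ 2)%:E)%E) ->
  hu @ \oo --> fine (h ub).
Proof.
move=> lsch pub uub hub huE ql qbl rm0 rmtau opt.
have c0 : (fun j => qb j + (2 * rm)^-1 * enorm (ub - p j) ^+ 2 - q j) @ \oo --> 0.
  have -> : 0 = l + (2 * rm)^-1 * (0 * 0) - l by rewrite !mulr0 addr0 subrr.
  apply: cvgB => //; apply: cvgD => //; apply: cvgMr.
  exact: (cvgM (enorm_cvg0 pub) (enorm_cvg0 pub)).
apply: (lsc_limsup_cvg lsch uub (esym (fineK hub)) huE _ c0) => j.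
have tau0 : 0 < tau j by exact: lt_trans (rmtau j).
have := opt j; rewrite -(fineK hub) -EFinD lee_fin.
have le1 : (2 * tau j)^-1 <= (2 * rm)^-1.
  by rewrite lef_pV2 ?posrE ?mulr_gt0// ler_pM2l// ltW.
have := ler_wpM2r (sqr_ge0 (enorm (ub - p j))) le1.
have : 0 <= (2 * tau j)^-1 * enorm (u j - p j) ^+ 2.
  by rewrite mulr_ge0 ?sqr_ge0// invr_ge0 mulr_ge0// ltW.
by rewrite /=; lra.
Qed.

End Sequences.

(** * Descent under the Kurdyka-Lojasiewicz inequality *)

Section KurdykaLojasiewicz.
Variable R : realType.

(** The graph of a concave function lies below its tangent at [s]: the
    difference quotients to the left of [s] are at most the slope of the chord
    over [[t, s]]. *)
Lemma desingularizing_tangent (eta : \bar R) (phi : R -> R) (s t : R) :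
  desingularizing eta phi -> 0 < t -> t <= s -> (s%:E < eta)%E ->
  derive1 phi s * (s - t) <= phi s - phi t.
Proof.
move=> [_ _ cphi _ dphi] t0; rewrite le_eqVlt => /predU1P[->|ts] seta.
  by rewrite !subrr mulr0.
have s0 : 0 < s by exact: lt_trans ts.
have st0 : 0 < s - t by rewrite subr_gt0.
have [ds _ _] := dphi s s0 seta.
rewrite -ler_pdivlMr//.
have ql : (fun h => h^-1 *: (phi (h + s) - phi s)) @ 0^'- --> derive1 phi s.
  apply: cvg_dnbhs_at_left; rewrite /derive1.
  move: ds; rewrite /derivable.
  by under eq_fun do rewrite /= [_ *: 1]mulr1.
apply: (cvgr_to_le ql).
near=> h.
have h0 : h < 0 by near: h; exact: nbhs_left_lt.
have hst : - (s - t) < h.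
  by near: h; apply: nbhs_left_gt; rewrite oppr_lt0.
(* h + s is the convex combination of t and s with weight p on t *)
pose p := - h / (s - t).
have p0 : 0 <= p by rewrite divr_ge0 ?oppr_ge0 ?ltW.
have p1 : p <= 1 by rewrite ler_pdivrMr// mul1r lerNl ltW.
have Dt : t \in [set s | 0 <= s /\ (s%:E < eta)%E].
  by rewrite inE; split; [exact: ltW|apply: lt_trans seta; rewrite lte_fin].
have Ds : s \in [set s | 0 <= s /\ (s%:E < eta)%E].
  by rewrite inE; split; [exact: ltW|].
have cts : p * t + (1 - p) * s = h + s by rewrite /p; field; rewrite gt_eqF.
have := cphi (Itv01 p0 p1) t s Dt Ds.
rewrite !convRE/= /unstable.onem [conv _ _ _](_ : _ = h + s); last exact: cts.
have -> : p * - phi t + (1 - p) * - phi s = p * (phi s - phi t) - phi s by ring.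
rewrite /p => hp.
have {}hp : phi s - phi (h + s) <= - h * ((phi s - phi t) / (s - t)).
  by rewrite mulrCA; move: hp; rewrite mulrAC; lra.
rewrite -[h^-1 *: _]/(h^-1 * _) ler_ndivrMl//; lra.
Unshelve. all: by end_near. Qed.

(** One step of the telescoping estimate: [dv] is the decrease of the value, [q]
    that of the desingularized value, [p] the slope of the desingularizing
    function, and [b * d'] bounds a subgradient.  The hypotheses give
    [d ^+ 2 <= d' * (b / a * q)]. *)
Lemma descent_step (a b d d' p q dv : R) :
  0 < a -> 0 < b -> 0 <= d' -> a * d ^+ 2 <= dv -> p * dv <= q ->
  1 <= p * (b * d') -> 2 * d <= d' + b / a * q.
Proof.
move=> a0 b0 d'0 adv pdv pbd.
have dv0 : 0 <= dv by rewrite (le_trans _ adv)// mulr_ge0 ?sqr_ge0 ?ltW.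
have ab0 : 0 < b / a by rewrite divr_gt0.
have le1 : d ^+ 2 <= d' * (b / a * q).
  have -> : d' * (b / a * q) = (q * (b * d')) / a by ring.
  rewrite ler_pdivlMr// mulrC (le_trans adv)//.
  rewrite (@le_trans _ _ (p * (b * d') * dv))// ?ler_peMl//.
  by rewrite mulrAC ler_wpM2r// mulr_ge0// ltW.
have d'1 : 0 < d'.
  rewrite lt_neqAle d'0 andbT; apply/eqP => d'E.
  by move: pbd; rewrite -d'E !mulr0 ler10.
have q0 : 0 <= b / a * q.
  by rewrite -(pmulr_rge0 _ d'1) (le_trans _ le1)// sqr_ge0.
move: (b / a * q) le1 q0 => c le1 c0.
rewrite leNgt; apply/negP => lt1.
have : (d' + c) ^+ 2 < (2 * d) ^+ 2.
  by rewrite ltr_pXn2r ?nnegrE ?addr_ge0// (le_trans _ (ltW lt1))// addr_ge0.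
(* 4 d' c <= (d' + c)^2 *)
have := sqr_ge0 (d' - c); nra.
Qed.

(** The step inequality is assumed only inside the ball of radius [rho].  Summed
    up to index [n], it bounds the length of the path, hence keeps the next term
    in the ball, and the induction goes on. *)
Lemma trapped_finite_length (V : normedModType R) (z : nat -> V) (zbar : V)
    (d psi : nat -> R) (rho : R) :
  (forall k, `|z k.+1 - z k| <= d k) -> (forall k, 0 <= psi k) ->
  `|z 0%N - zbar| + 2 * d 0%N + psi 1%N < rho ->
  (forall k, `|z k - zbar| < rho -> `|z k.+1 - zbar| < rho ->
    2 * d k.+1 <= d k + (psi k.+1 - psi k.+2)) ->
  forall n, \sum_(k < n) d k <= 2 * d 0%N + psi 1%N.
Proof.
move=> zd psi0 start step.
have d0 k : 0 <= d k by exact: le_trans (zd k).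
have dist_succ k : `|z k.+1 - zbar| <= `|z k - zbar| + d k.
  have -> : z k.+1 - zbar = (z k - zbar) + (z k.+1 - z k).
    by rewrite [RHS]addrC subrKA.
  by apply: le_trans (ler_normD _ _) _; rewrite lerD2l.
have key n : [/\ `|z n - zbar| < rho, `|z n.+1 - zbar| < rho,
    `|z n.+1 - zbar| <= `|z 0%N - zbar| + \sum_(k < n.+1) d k &
    \sum_(k < n.+1) d k + d n <= 2 * d 0%N + psi 1%N - psi n.+1].
  elim: n => [|n [zn zn1 zS dS]].
    have := dist_succ 0%N; have := d0 0%N; have := psi0 1%N.
    by rewrite big_ord_recr big_ord0/= => *; split; lra.
  have := dist_succ n.+1; have := step n zn zn1; have := psi0 n.+2.
  have := d0 n.+1.
  rewrite [\sum_(k < n.+2) _]big_ord_recr/= => dn1 pn2 st ds.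
  by split=> //; lra.
case=> [|n]; first by rewrite big_ord0 addr_ge0// mulr_ge0.
have [_ _ _] := key n; have := d0 n; have := psi0 n.+1; lra.
Qed.

Lemma descent_increment_cvg0 (v d : nat -> R) (a c : R) :
  0 < a -> (forall k, 0 <= d k) ->
  (forall k, v k.+1 + a * d k ^+ 2 <= v k) -> v @ \oo --> c ->
  d @ \oo --> 0.
Proof.
move=> a0 d0 desc vc; apply/cvgrPdist_lt => e e0.
have ae : 0 < a * e ^+ 2 by rewrite mulr_gt0// exprn_gt0.
have vv : (fun k => v k - v k.+1) @ \oo --> 0.
  rewrite -(subrr c); apply: cvgB => //.
  by have := vc; rewrite -(cvg_shiftS v).
near=> k; rewrite sub0r normrN ger0_norm//.
have vk : v k - v k.+1 < a * e ^+ 2 by near: k; exact: (cvgr_lt _ vv).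
rewrite -(@ltr_pXn2r _ 2)// ?nnegrE// ?(ltW e0)//.
rewrite -(ltr_pM2l a0); apply: le_lt_trans vk.
by have := desc k; lra.
Unshelve. all: by end_near. Qed.

(** If the values reach their limit, then the sequence is stationary.  Otherwise
    the Kurdyka-Lojasiewicz inequality applies at every term close to [zbar],
    and [trapped_finite_length] applies from some late index [K] on. *)
Lemma KL_finite_length N (h : 'rV[R]_N -> \bar R) (zbar : 'rV[R]_N)
    (z : nat -> 'rV[R]_N) (v d : nat -> R) (c a b r : R) :
  KL_property h zbar -> h zbar = c%:E -> (forall k, h (z k) = (v k)%:E) ->
  0 < a -> 0 < b -> 0 < r ->
  (forall k, `|z k.+1 - z k| <= d k) ->
  (forall k, v k.+1 + a * d k ^+ 2 <= v k) ->
  (forall k, `|z k - zbar| < r -> `|z k.+1 - zbar| < r ->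
    exists2 w, subdiff h (z k.+1) w & enorm w <= b * d k) ->
  cluster (z @ \oo) zbar -> v @ \oo --> c ->
  exists C, forall n, \sum_(k < n) d k <= C.
Proof.
move=> [eta [U [phi [eta0 Uzbar Dphi KL]]]] hzbar hz a0 b0 r0 zd desc relerr.
move=> /cluster_seqP freq vc.
have d0 k : 0 <= d k by exact: le_trans (zd k).
have vnd : nonincreasing_seq v.
  apply/nonincreasing_seqP => k; apply: le_trans (desc k).
  by rewrite lerDl mulr_ge0 ?sqr_ge0 ?ltW.
have cv k : c <= v k.
  rewrite -(cvg_lim _ vc)//; apply: nonincreasing_cvgn_ge => //.
  by apply/cvg_ex; exists c.
(* once a value equals the limit, the descent makes all later steps vanish *)
have [[k0 vk0]|/forallNP vNc] := pselect (exists k, v k = c).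
  have dk0 k : (k0 <= k)%N -> d k = 0.
    move=> /vnd; rewrite vk0 => vkc.
    have vk : v k = c by apply/eqP; rewrite eq_le vkc cv.
    have := desc k; rewrite vk => ck.
    have : a * d k ^+ 2 <= 0 by have := cv k.+1; lra.
    rewrite pmulr_rle0// => dk2; apply/eqP.
    by rewrite -sqrf_eq0 eq_le dk2 sqr_ge0.
  exists (\sum_(k < k0) d k) => n.
  have [nk|kn] := leqP n k0.
    rewrite -!(big_mkord xpredT) [leRHS](big_cat_nat (leq0n n) nk)//=.
    by rewrite lerDl sumr_ge0.
  rewrite -!(big_mkord xpredT) (big_cat_nat (leq0n k0) (ltnW kn))//=.
  have -> : \sum_(k0 <= k < n) d k = 0; last by rewrite addr0.
  by rewrite big_nat_cond big1// => k /andP[/andP[/dk0]].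
have vgtc k : c < v k by rewrite lt_neqAle cv andbT eq_sym; apply/eqP/vNc.
(* the gap s tends to 0 from above, hence within the domain of phi *)
pose s k := v k - c.
have s0 k : 0 < s k by rewrite subr_gt0.
have scvg : s @ \oo --> 0.
  by rewrite -(subrr c); apply: cvgB => //; exact: cvg_cst.
have seta : \forall k \near \oo, ((s k)%:E < eta)%E.
  case: eta eta0 {Dphi KL} => [e||] //; last first.
    by move=> _; near=> k; rewrite ltry.
  rewrite lte_fin => e0; near=> k; rewrite lte_fin.
  by near: k; apply: (cvgr_lt _ scvg).
have phis : (phi \o s) @ \oo --> 0.
  have [_ cphi _ phi0 _] := Dphi.
  rewrite -phi0; move/subspace_continuousP : cphi => /(_ 0)/=.
  move=> /(_ (conj (lexx 0) eta0)) cphi.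
  apply: (cvg_comp _ _ _ cphi) => A [e e0 eA].
  suff : \forall k \near \oo, A (s k) by [].
  near=> k; apply: eA => /=; last by split; [exact: ltW (s0 k)|near: k].
  by near: k; move/cvgrPdist_lt : scvg; apply.
have dcvg := descent_increment_cvg0 a0 d0 desc vc.
have [rho [rho0 rhor rhoU]] : exists rho, [/\ 0 < rho, rho <= r &
    forall x, `|x - zbar| < rho -> U x].
  case/nbhs_ballP : Uzbar => e /= e0 eU; exists (Num.min e r); split.
  - by rewrite lt_min e0.
  - by rewrite ge_min lexx orbT.
  - by move=> x; rewrite lt_min distrC => /andP[xe _]; apply: eU; rewrite -ball_normE.
have C0 : 0 < b / a by rewrite divr_gt0.
have psicvg : (fun k => 2 * d k + b / a * phi (s k.+1)) @ \oo --> 0.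
  rewrite -[X in _ --> X](addr0 0) -{1}(mulr0 2) -[X in _ + X](mulr0 (b / a)).
  apply: cvgD; apply: cvgMr => //.
  by have := phis; rewrite -(cvg_shiftS (phi \o s)).
have [K0 _ K0P] : \forall k \near \oo, ((s k)%:E < eta)%E /\
    2 * d k + b / a * phi (s k.+1) < rho / 2.
  near=> k; split; first by near: k.
  by near: k; apply: (cvgr_lt _ psicvg); rewrite divr_gt0.
have [K /K0P /= [sK psiK] zK] := freq (rho / 2) (divr_gt0 rho0 (ltr0Sn _ _)) K0.
have sKn n : ((s (K + n)%N)%:E < eta)%E.
  apply: le_lt_trans sK; rewrite lee_fin lerD2r; apply: vnd.
  exact: leq_addr.
have phi_ge0 n : 0 <= phi (s (K + n)%N).
  by case: Dphi => + _ _ _ _; apply; split => //; exact: ltW (s0 _).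
exists (\sum_(k < K) d k + (2 * d K + b / a * phi (s K.+1))) => n.
apply: (@le_trans _ _ (\sum_(k < K + n) d k)).
  rewrite -!(big_mkord xpredT) [leRHS](big_cat_nat (leq0n n) (leq_addl K n))/=.
  by rewrite lerDl sumr_ge0.
rewrite big_split_ord/= lerD2l.
have := @trapped_finite_length _ (fun n => z (K + n)%N) zbar
  (fun n => d (K + n)%N) (fun n => b / a * phi (s (K + n)%N)) rho.
rewrite addn0 addn1; apply.
- by move=> k; rewrite addnS.
- by move=> k; rewrite mulr_ge0// ltW.
- lra.
move=> k; rewrite !addnS => zk zk1; rewrite -mulrBr.
have [w hw wb] := relerr (K + k)%N (lt_le_trans zk rhor) (lt_le_trans zk1 rhor).
have := KL (z (K + k).+1) (rhoU _ zk1).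
rewrite hzbar hz lte_fin => /(_ (vgtc _)).
rewrite -EFinB/= -/(s _) => KL1.
have {}KL1 : (1 <= (derive1 phi (s (K + k).+1))%:E *
    dist 0 (subdiff h (z (K + k).+1)))%E.
  apply: KL1; move: (sKn k.+1); rewrite addnS /s.
  by rewrite EFinB lteBlDl.
have [_ _ _ _ /(_ (s (K + k).+1) (s0 _))] := Dphi.
rewrite -addnS => /(_ (sKn _)) [_ _]; rewrite addnS => phi'0.
apply: (descent_step a0 b0 (d0 _) (p := derive1 phi (s (K + k).+1))
  (dv := s (K + k).+1 - s (K + k).+2)).
- by rewrite /s; have := desc (K + k).+1; lra.
- apply: (desingularizing_tangent Dphi) => //.
    by rewrite lerD2r vnd.
  by rewrite -addnS.
- rewrite -lee_fin; apply: (le_trans KL1); rewrite EFinM.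
  rewrite lee_wpmul2l ?lee_fin ?(ltW phi'0)//.
  apply: (@le_trans _ _ (enorm w)%:E); last by rewrite lee_fin.
  by apply: ereal_inf_lbound; exists w => //; rewrite sub0r enormN.
Unshelve. all: by end_near. Qed.

(** The subgradients along a subsequence tend to 0 because the steps do, and the
    values converge by assumption, so 0 is a limiting subgradient. *)
Lemma cluster_point_critical N (h : 'rV[R]_N -> \bar R) (zbar : 'rV[R]_N)
    (z w : nat -> 'rV[R]_N) (v d : nat -> R) (c b r : R) :
  cluster (z @ \oo) zbar -> (forall k, `|z k.+1 - z k| <= d k) ->
  d @ \oo --> 0 -> h zbar = c%:E -> (forall k, h (z k) = (v k)%:E) ->
  v @ \oo --> c -> 0 < b -> 0 < r ->
  (forall k, frechet_subdiff h (z k.+1) (w k)) ->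
  (forall k, `|z k - zbar| <= r -> `|z k.+1 - zbar| <= r ->
    enorm (w k) <= b * d k) ->
  critical_point h zbar.
Proof.
move=> zbarP zd dcvg hzbar hz vc b0 r0 hw wb.
have [s [s_oo zs zs1]] := cluster_subsequence zbarP zd dcvg.
have ds : (fun j => d (s j)) @ \oo --> 0 by exact: (cvg_comp _ _ s_oo dcvg).
have vs : (fun j => v (s j).+1) @ \oo --> c.
  apply: (cvg_comp _ _ s_oo (_ : (fun k => v k.+1) @ \oo --> c)).
  by have := vc; rewrite -(cvg_shiftS v).
have hs : (fun j => h (z (s j).+1)) @ \oo --> h zbar.
  rewrite hzbar; apply: cvg_EFin; first by apply: nearW => j; rewrite hz.
  by under eq_fun do rewrite /= hz; exact: vs.
have ws : (fun j => w (s j)) @ \oo --> (0 : 'rV[R]_N).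
  apply/cvgrPdist_le => e e0; near=> j; rewrite sub0r normrN.
  apply: (le_trans (norm_le_enorm _)).
  apply: (@le_trans _ _ (b * d (s j))).
    apply: wb; rewrite distrC; near: j.
      by move/cvgrPdist_le : zs; apply.
    by move/cvgrPdist_le : zs1; apply.
  rewrite mulrC -ler_pdivlMr//; near: j.
  by apply: (cvgr_le _ ds); rewrite divr_gt0.
split; first by rewrite /edom /= hzbar ltry.
exists (fun j => z (s j).+1), (fun j => w (s j)).
by split; [exact: zs1|exact: hs|move=> j; exact: hw|exact: ws].
Unshelve. all: by end_near. Qed.

End KurdykaLojasiewicz.

(** * One step of the alternating algorithm *)

Section AlternatingStep.
Variable R : realType.

(** Both optimality conditions together say that [L - S] is minimal at the new
    pair, where [S] subtracts from [Q] the smooth parts of the two objectives;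
    the subgradient is the gradient of [S].  The second block of [grad Q]
    cancels since the [y]-step already uses the updated [x]. *)
Lemma alternating_step_subgradient n m
    (f : 'rV[R]_n -> \bar R) (g : 'rV[R]_m -> \bar R)
    (Q : 'rV[R]_(n + m) -> R) (L : 'rV[R]_(n + m) -> \bar R)
    (xp xn : 'rV[R]_n) (yp yn : 'rV[R]_m) (lam mu a b : R) :
  (forall u v, L (row_mx u v) = (f u + (Q (row_mx u v))%:E + g v)%E) ->
  (forall z, differentiable Q z) ->
  (forall u, (-oo < f u)%E) -> (forall v, (-oo < g v)%E) ->
  0 < lam -> 0 < mu -> f xn = a%:E -> g yn = b%:E ->
  (forall u, ((a + (Q (row_mx xn yp) + (2 * lam)^-1 * enorm (xn - xp) ^+ 2))%:E
    <= f u + (Q (row_mx u yp) + (2 * lam)^-1 * enorm (u - xp) ^+ 2)%:E)%E) ->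
  (forall v, ((b + (Q (row_mx xn yn) + (2 * mu)^-1 * enorm (yn - yp) ^+ 2))%:E
    <= g v + (Q (row_mx xn v) + (2 * mu)^-1 * enorm (v - yp) ^+ 2)%:E)%E) ->
  frechet_subdiff L (row_mx xn yn)
    (row_mx (lsubmx (grad Q (row_mx xn yn) - grad Q (row_mx xn yp))
             - lam^-1 *: (xn - xp)) (- (mu^-1 *: (yn - yp)))).
Proof.
move=> HL dQ fNy gNy lam0 mu0 fxn gyn optx opty.
set zn := row_mx xn yn.
pose X u := Q (row_mx u yp) + (2 * lam)^-1 * enorm (u - xp) ^+ 2.
pose Y v := Q (row_mx xn v) + (2 * mu)^-1 * enorm (v - yp) ^+ 2.
have gradX : has_gradient X xn (lsubmx (grad Q (row_mx xn yp))
    + lam^-1 *: (xn - xp)).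
  have -> : lam^-1 = 2 * (2 * lam)^-1 by field; rewrite gt_eqF.
  apply: has_gradientD.
    exact: (has_gradient_slicel (differentiable_has_gradient (dQ _))).
  by apply: has_gradient_sqr_dist; rewrite invr_gt0 mulr_gt0.
have gradY : has_gradient Y yn (rsubmx (grad Q zn) + mu^-1 *: (yn - yp)).
  have -> : mu^-1 = 2 * (2 * mu)^-1 by field; rewrite gt_eqF.
  apply: has_gradientD.
    exact: (has_gradient_slicer (differentiable_has_gradient (dQ _))).
  by apply: has_gradient_sqr_dist; rewrite invr_gt0 mulr_gt0.
pose S w := Q w - X (lsubmx w) - Y (rsubmx w).
have gradS : has_gradient S zn (grad Q zn
    - row_mx (lsubmx (grad Q (row_mx xn yp)) + lam^-1 *: (xn - xp)) 0
    - row_mx 0 (rsubmx (grad Q zn) + mu^-1 *: (yn - yp))).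
  apply: has_gradientB; first apply: has_gradientB.
  - exact: differentiable_has_gradient.
  - by apply: has_gradient_lsubmx; rewrite row_mxKl.
  - by apply: has_gradient_rsubmx; rewrite row_mxKr.
set w := row_mx _ _.
have -> : w = grad Q zn
    - row_mx (lsubmx (grad Q (row_mx xn yp)) + lam^-1 *: (xn - xp)) 0
    - row_mx 0 (rsubmx (grad Q zn) + mu^-1 *: (yn - yp)).
  rewrite -{1}[grad Q zn]hsubmxK !opp_row_mx !add_row_mx !oppr0 !addr0.
  rewrite /w; congr row_mx; first by rewrite raddfB opprD addrA.
  by rewrite opprD addrA subrr add0r.
apply: (frechet_subdiff_touching _ gradS).
  by rewrite HL fxn gyn.
move=> v; rewrite -[v]hsubmxK HL /S row_mxKl row_mxKr /zn row_mxKl row_mxKr.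
rewrite -/zn HL fxn gyn.
have := optx (lsubmx v); have := opty (rsubmx v).
case: (f (lsubmx v)) (fNy (lsubmx v)) => [p| |] // _; last first.
  by move=> _ _; rewrite addye ?leey// gt_eqF// gNy.
case: (g (rsubmx v)) (gNy (rsubmx v)) => [q| |] // _; last first.
  by move=> _ _; rewrite addey// leey.
rewrite -!EFinD !lee_fin /X /Y; lra.
Qed.

(** The mixed pair [row_mx xn yp] lies in the unit ball around [zbar] with the
    other two because the sup norm treats the coordinates separately. *)
Lemma alternating_step_subgradient_bound n m (G : 'rV[R]_(n + m) -> 'rV[R]_(n + m))
    (zbar : 'rV[R]_(n + m)) (M rm lam mu : R) (xp xn : 'rV[R]_n) (yp yn : 'rV[R]_m) :
  (forall z w, `|z - zbar| <= 1 -> `|w - zbar| <= 1 ->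
     enorm (G z - G w) <= M * enorm (z - w)) ->
  0 < rm -> rm < lam -> rm < mu ->
  `|row_mx xp yp - zbar| <= 1 -> `|row_mx xn yn - zbar| <= 1 ->
  enorm (row_mx (lsubmx (G (row_mx xn yn) - G (row_mx xn yp))
             - lam^-1 *: (xn - xp)) (- (mu^-1 *: (yn - yp)))) <=
  (n + m).+1%:R * (`|M| + rm^-1) * (enorm (xn - xp) + enorm (yn - yp)).
Proof.
move=> lipG rm0 rml rmmu zp zn.
have dx := enorm_ge0 (xn - xp); have dy := enorm_ge0 (yn - yp).
have rmV : 0 < rm^-1 by rewrite invr_gt0.
have K0 : 0 <= (`|M| + rm^-1) * (enorm (xn - xp) + enorm (yn - yp)).
  by rewrite mulr_ge0 ?addr_ge0// ltW.
have inv_le l (N : nat) (u : 'rV[R]_N) : rm < l -> `|l^-1 *: u| <= rm^-1 * enorm u.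
  move=> rl; have l0 : 0 < l by exact: lt_trans rl.
  rewrite normrZ ger0_norm ?invr_ge0 ?(ltW l0)//.
  apply: ler_pM; rewrite ?invr_ge0 ?(ltW l0) ?norm_le_enorm//.
  by rewrite lef_pV2 ?posrE// (ltW rl).
apply: (le_trans (enorm_le_norm _)); rewrite -mulrA.
apply: ler_pM => //; first by rewrite ler_nat.
apply: norm_row_mx_le; last first.
  rewrite normrN (le_trans (inv_le _ _ _ rmmu))//.
  by apply: ler_pM; rewrite ?(ltW rmV) ?lerDr ?lerDl.
apply: (le_trans (ler_normB _ _)).
have split_zbar (u : 'rV[R]_n) (v : 'rV[R]_m) :
    row_mx u v - zbar = row_mx (u - lsubmx zbar) (v - rsubmx zbar).
  by rewrite -{1}[zbar]hsubmxK opp_row_mx add_row_mx.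
have zm : `|row_mx xn yp - zbar| <= 1.
  rewrite split_zbar; apply: norm_row_mx_le.
    apply: le_trans zn; apply: le_trans (norm_lsubmx_le _).
    by rewrite split_zbar row_mxKl.
  apply: le_trans zp; apply: le_trans (norm_rsubmx_le _).
  by rewrite split_zbar row_mxKr.
have := lipG _ _ zn zm.
rewrite opp_row_mx add_row_mx subrr enorm_0row => GM.
have Gle : `|lsubmx (G (row_mx xn yn) - G (row_mx xn yp))| <= `|M| * enorm (yn - yp).
  apply: (le_trans (norm_lsubmx_le _)); apply: (le_trans (norm_le_enorm _)).
  by apply: (le_trans GM); rewrite ler_wpM2r// ler_norm.
have := inv_le _ _ (xn - xp) rml.
have := mulr_ge0 (normr_ge0 M) dx; have := mulr_ge0 (ltW rmV) dy.
by move: Gle; lra.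
Qed.

End AlternatingStep.

(** * The iterates of the alternating algorithm *)

(** The iterates are taken from index 1 on: [L] may be [+oo] at the starting
    point. *)
Definition joint_iterate (R : realType) (n m : nat)
    (x : nat -> 'rV[R]_n) (y : nat -> 'rV[R]_m) (k : nat) : 'rV[R]_(n + m) :=
  row_mx (x k.+1) (y k.+1).

Definition step_length (R : realType) (n m : nat)
    (x : nat -> 'rV[R]_n) (y : nat -> 'rV[R]_m) (k : nat) : R :=
  enorm (x k.+2 - x k.+1) + enorm (y k.+2 - y k.+1).

Lemma step_length_ge0 (R : realType) (n m : nat)
    (x : nat -> 'rV[R]_n) (y : nat -> 'rV[R]_m) (k : nat) :
  0 <= step_length x y k.
Proof. by rewrite addr_ge0 ?enorm_ge0. Qed.

Lemma joint_iterate_dist (R : realType) (n m : nat)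
    (x : nat -> 'rV[R]_n) (y : nat -> 'rV[R]_m) (k : nat) :
  `|joint_iterate x y k.+1 - joint_iterate x y k| <= step_length x y k.
Proof.
rewrite opp_row_mx add_row_mx; apply: norm_row_mx_le.
  by apply: (le_trans (norm_le_enorm _)); rewrite lerDl enorm_ge0.
by apply: (le_trans (norm_le_enorm _)); rewrite lerDr enorm_ge0.
Qed.

Section AlternatingProximal.
Variables (R : realType) (n m : nat).
Variables (f : 'rV[R]_n -> \bar R) (g : 'rV[R]_m -> \bar R).
Variables (Q : 'rV[R]_(n + m) -> R) (L : 'rV[R]_(n + m) -> \bar R).
Variables (lambda mu : nat -> R) (x : nat -> 'rV[R]_n) (y : nat -> 'rV[R]_m).
Variables (rm rp : R).

Hypothesis L_split : forall u v,
  L (row_mx u v) = (f u + (Q (row_mx u v))%:E + g v)%E.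
Hypothesis f_gtNy : forall u, (-oo < f u)%E.
Hypothesis g_gtNy : forall v, (-oo < g v)%E.
Hypothesis L_start : exists u, (L (row_mx u (y 0%N)) < +oo)%E.
Hypothesis xy_alg : alternating_proximal L lambda mu x y.
Hypothesis rm_gt0 : 0 < rm.
Hypothesis lambda_bounds : forall k, rm < lambda k < rp.
Hypothesis mu_bounds : forall k, rm < mu k < rp.

Local Notation z := (joint_iterate x y).
Local Notation d := (step_length x y).

(** The first half-step makes [L (row_mx (x 1) (y 0))] finite, and every later
    half-step can only decrease [L]. *)
Lemma alternating_finite k : f (x k.+1) \is a fin_num /\ g (y k) \is a fin_num.
Proof.
have sum_fin u v : (L (row_mx u v) < +oo)%E ->
    f u \is a fin_num /\ g v \is a fin_num.
  by rewrite L_split; have := f_gtNy u; have := g_gtNy v;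
    case: (f u); case: (g v).
have add_fin (a b : \bar R) (s t : R) : (a + s%:E <= b + t%:E)%E ->
    (b < +oo)%E -> (a < +oo)%E.
  by case: a => [a| |]; case: b => [b| |] // _ _; rewrite ltry.
apply: sum_fin; have [u0 Lu0] := L_start.
elim: k => [|k IH].
  by have /= /add_fin := (xy_alg 0%N).1 u0; exact.
have /= /add_fin step1 := (xy_alg k.+1).1 (x k.+1).
by have /= /add_fin step2 := (xy_alg k).2 (y k); exact/step1/step2.
Qed.

Lemma f_iterateE k : f (x k.+1) = (fine (f (x k.+1)))%:E.
Proof. by rewrite fineK//; exact: (alternating_finite k).1. Qed.

Lemma g_iterateE k : g (y k) = (fine (g (y k)))%:E.
Proof. by rewrite fineK//; exact: (alternating_finite k).2. Qed.

Lemma L_iterateE k : L (z k) =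
  (fine (f (x k.+1)) + Q (z k) + fine (g (y k.+1)))%:E.
Proof. by rewrite L_split f_iterateE g_iterateE. Qed.

Lemma x_step_optimal k u :
  ((fine (f (x k.+1)) + (Q (row_mx (x k.+1) (y k))
      + (2 * lambda k)^-1 * enorm (x k.+1 - x k) ^+ 2))%:E
  <= f u + (Q (row_mx u (y k)) + (2 * lambda k)^-1 * enorm (u - x k) ^+ 2)%:E)%E.
Proof.
have := (xy_alg k).1 u; rewrite !L_split f_iterateE g_iterateE.
case: (f u) (f_gtNy u) => [a| |] //= _; last by move=> _; rewrite leey.
by rewrite -!EFinD !lee_fin; lra.
Qed.

Lemma y_step_optimal k v :
  ((fine (g (y k.+1)) + (Q (row_mx (x k.+1) (y k.+1))
      + (2 * mu k)^-1 * enorm (y k.+1 - y k) ^+ 2))%:E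
  <= g v + (Q (row_mx (x k.+1) v) + (2 * mu k)^-1 * enorm (v - y k) ^+ 2)%:E)%E.
Proof.
have := (xy_alg k).2 v; rewrite !L_split f_iterateE g_iterateE.
case: (g v) (g_gtNy v) => [a| |] //= _; last by move=> _; rewrite leey.
by rewrite -!EFinD !lee_fin; lra.
Qed.

(** Test the two minimizations with the previous iterate and add up. *)
Lemma value_descent k :
  fine (L (z k.+1)) + (4 * rp)^-1 * d k ^+ 2 <= fine (L (z k)).
Proof.
have rp_gt0 : 0 < rp.
  by case/andP: (mu_bounds 0%N) => /(lt_trans rm_gt0); exact: lt_trans.
rewrite !L_iterateE /=.
have := x_step_optimal k.+1 (x k.+1); have := y_step_optimal k.+1 (y k.+1).
rewrite (f_iterateE k) (g_iterateE k.+1) -!EFinD !lee_fin !subrr !enorm0.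
rewrite expr0n/= !mulr0 !addr0 /joint_iterate /step_length.
set dx := enorm (x _ - _); set dy := enorm (y _ - _).
have rpV l : rm < l < rp -> 2 * (4 * rp)^-1 <= (2 * l)^-1.
  case/andP=> rml lrp; have l0 : 0 < l by exact: lt_trans rml.
  have -> : 2 * (4 * rp)^-1 = (2 * rp)^-1 by field; rewrite gt_eqF.
  by rewrite lef_pV2 ?posrE ?mulr_gt0// ler_pM2l// ltW.
have lx := ler_wpM2r (sqr_ge0 dx) (rpV _ (lambda_bounds k.+1)).
have ly := ler_wpM2r (sqr_ge0 dy) (rpV _ (mu_bounds k.+1)).
(* (dx + dy)^2 <= 2 dx^2 + 2 dy^2 *)
have a_ge0 : 0 <= (4 * rp)^-1 by rewrite invr_ge0 mulr_ge0// ltW.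
have := mulr_ge0 a_ge0 (sqr_ge0 (dx - dy)).
by move: lx ly; lra.
Qed.

Hypothesis Q_diff : forall w, differentiable Q w.

(** The radius 1 is arbitrary: it only fixes a bounded set on which [grad Q] has
    a Lipschitz constant. *)
Lemma iterate_subgradient (zbar : 'rV[R]_(n + m)) :
  lipschitz_on_bounded (grad Q) ->
  exists (b : R) (w : nat -> 'rV[R]_(n + m)),
    [/\ 0 < b, forall k, frechet_subdiff L (z k.+1) (w k) &
        forall k, `|z k - zbar| <= 1 -> `|z k.+1 - zbar| <= 1 ->
          enorm (w k) <= b * d k].
Proof.
move=> gradQ_lip.
have [M lipM] : exists M, forall u w, `|u - zbar| <= 1 -> `|w - zbar| <= 1 ->
    enorm (grad Q u - grad Q w) <= M * enorm (u - w).
  have Bb : bounded_set [set u : 'rV[R]_(n + m) | `|u - zbar| <= 1].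
    exists (1 + `|zbar|); split; first exact: num_real.
    move=> e /ltW he u /= ue; apply: le_trans he.
    rewrite -[u](subrK zbar); apply: (le_trans (ler_normD _ _)).
    by rewrite lerD2r.
  by have [M MP] := gradQ_lip _ Bb; exists M => u w; exact: MP.
have stepP l : rm < l < rp -> 0 < l /\ rm < l.
  by case/andP=> rml _; split=> //; exact: lt_trans rml.
eexists ((n + m).+1%:R * (`|M| + rm^-1)), _; split.
- by rewrite mulr_gt0// ltr_wpDl// invr_gt0.
- move=> k; exact: (alternating_step_subgradient L_split Q_diff f_gtNy g_gtNy
    (stepP _ (lambda_bounds k.+1)).1 (stepP _ (mu_bounds k.+1)).1
    (f_iterateE _) (g_iterateE _) (x_step_optimal _) (y_step_optimal _)).
- move=> k zk zk1; apply: (alternating_step_subgradient_bound lipM rm_gt0) => //.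
    exact: (stepP _ (lambda_bounds k.+1)).2.
  exact: (stepP _ (mu_bounds k.+1)).2.
Qed.

Hypothesis f_lsc : lower_semicontinuous f.
Hypothesis g_lsc : lower_semicontinuous g.

(** [L] is only lower semicontinuous, so its continuity along a convergent
    subsequence has to come from the minimizations: the values of [f] and [g]
    converge separately, and [Q] is continuous. *)
Lemma cluster_point_value (zbar : 'rV[R]_(n + m)) (c : R) :
  cluster (z @ \oo) zbar -> d @ \oo --> 0 ->
  (fun k => fine (L (z k))) @ \oo --> c -> L zbar = c%:E.
Proof.
move=> zbarP dcvg vc.
have [s [s_oo zs zs1]] := cluster_subsequence zbarP (joint_iterate_dist x y) dcvg.
pose xb := lsubmx zbar; pose yb := rsubmx zbar.
have zbarE : zbar = row_mx xb yb by rewrite hsubmxK.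
have xs1 : (fun j => x (s j).+1) @ \oo --> xb.
  have -> : (fun j => x (s j).+1) = (fun j => lsubmx (z (s j))).
    by apply/funext => j; rewrite row_mxKl.
  exact: cvg_lsubmx.
have ys1 : (fun j => y (s j).+1) @ \oo --> yb.
  have -> : (fun j => y (s j).+1) = (fun j => rsubmx (z (s j))).
    by apply/funext => j; rewrite row_mxKr.
  exact: cvg_rsubmx.
have xs2 : (fun j => x (s j).+2) @ \oo --> xb.
  have -> : (fun j => x (s j).+2) = (fun j => lsubmx (z (s j).+1)).
    by apply/funext => j; rewrite row_mxKl.
  exact: cvg_lsubmx.
have ys2 : (fun j => y (s j).+2) @ \oo --> yb.
  have -> : (fun j => y (s j).+2) = (fun j => rsubmx (z (s j).+1)).
    by apply/funext => j; rewrite row_mxKr.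
  exact: cvg_rsubmx.
have Qcvg (u : nat -> 'rV[R]_n) (w : nat -> 'rV[R]_m) :
    u @ \oo --> xb -> w @ \oo --> yb ->
    (fun j => Q (row_mx (u j) (w j))) @ \oo --> Q zbar.
  move=> ub wb; rewrite zbarE; apply: (cvg_comp _ Q (cvg_row_mx ub wb)).
  exact: (differentiable_continuous (Q_diff _)).
pose F j := fine (f (x (s j).+2)); pose G j := fine (g (y (s j).+2)).
have vs : (fun j => fine (L (z (s j).+1))) @ \oo --> c.
  apply: (cvg_comp _ _ s_oo (_ : (fun k => fine (L (z k.+1))) @ \oo --> c)).
  by have := vc; rewrite -(cvg_shiftS (fun k => fine (L (z k)))).
have vE j : fine (L (z (s j).+1)) = F j + Q (z (s j).+1) + G j.
  by rewrite L_iterateE.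
have Qzs := Qcvg _ _ xs2 ys2.
have bounded_sum : \forall j \near \oo, F j + G j <= c + 1 - (Q zbar - 1).
  near=> j.
  have : Q zbar - 1 <= Q (z (s j).+1).
    by near: j; apply: (cvgr_ge _ Qzs); rewrite ltrBlDr ltrDl.
  have : fine (L (z (s j).+1)) <= c + 1.
    by near: j; apply: (cvgr_le _ vs); rewrite ltrDl.
  by rewrite vE; lra.
have fxb : f xb \is a fin_num.
  exact: (lsc_sum_bounded_fin f_lsc g_lsc xs2 ys2 (fun j => f_iterateE _)
    (fun j => g_iterateE _) (f_gtNy _) (g_gtNy _) bounded_sum).
have gyb : g yb \is a fin_num.
  apply: (lsc_sum_bounded_fin g_lsc f_lsc ys2 xs2 (fun j => g_iterateE _)
    (fun j => f_iterateE _) (g_gtNy _) (f_gtNy _)).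
  by under eq_near do rewrite addrC; exact: bounded_sum.
have rm_lt l : rm < l < rp -> rm < l by case/andP.
(* the smooth term moves from its value at the minimizer to that at xb, yb,
   and both tend to Q zbar *)
have Fcvg : F @ \oo --> fine (f xb).
  exact: (prox_value_cvg f_lsc xs1 xs2 fxb (fun j => f_iterateE _)
    (Qcvg _ _ xs2 ys1) (Qcvg _ _ (cvg_cst xb) ys1) rm_gt0
    (fun j => rm_lt _ (lambda_bounds (s j).+1))
    (fun j => x_step_optimal (s j).+1 xb)).
have Gcvg : G @ \oo --> fine (g yb).
  exact: (prox_value_cvg g_lsc ys1 ys2 gyb (fun j => g_iterateE _)
    (Qcvg _ _ xs2 ys2) (Qcvg _ _ xs2 (cvg_cst yb)) rm_gt0
    (fun j => rm_lt _ (mu_bounds (s j).+1))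
    (fun j => y_step_optimal (s j).+1 yb)).
have lim_sum : (fun j => fine (L (z (s j).+1))) @ \oo -->
    fine (f xb) + Q zbar + fine (g yb).
  have -> : (fun j => fine (L (z (s j).+1))) =
      (fun j => F j + Q (z (s j).+1) + G j) by apply/funext.
  by apply: cvgD => //; apply: cvgD.
have cE : c = fine (f xb) + Q zbar + fine (g yb).
  exact: (cvg_unique _ vs lim_sum).
by rewrite zbarE L_split -(fineK fxb) -(fineK gyb) -zbarE cE !EFinD.
Unshelve. all: by end_near. Qed.

End AlternatingProximal.

Theorem theorem9 (R : realType) (n m : nat)
    (f : 'rV[R]_n -> \bar R) (g : 'rV[R]_m -> \bar R)
    (Q : 'rV[R]_(n + m) -> R) (L : 'rV[R]_(n + m) -> \bar R)
    (HL : forall (u : 'rV[R]_n) (v : 'rV[R]_m),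
        L (row_mx u v) = (f u + (Q (row_mx u v))%:E + g v)%E)
    (f_proper : proper_fun f) (f_lsc : lower_semicontinuous f)
    (g_proper : proper_fun g) (g_lsc : lower_semicontinuous g)
    (Q_C1 : C1 Q) (gradQ_lip : lipschitz_on_bounded (grad Q))
    (x0 : 'rV[R]_n) (y0 : 'rV[R]_m)
    (infL : (-oo < ereal_inf (range L))%E)
    (Ly0_proper : proper_fun (fun u : 'rV[R]_n => L (row_mx u y0)))
    (rm rp : R) (rm_gt0 : 0 < rm) (rm_lt_rp : rm < rp)
    (lambda mu : nat -> R)
    (lambda_bounds : forall k : nat, rm < lambda k < rp)
    (mu_bounds : forall k : nat, rm < mu k < rp)
    (L_KL : forall z : 'rV[R]_(n + m), dom_subdiff L z -> KL_property L z)
    (x : nat -> 'rV[R]_n) (y : nat -> 'rV[R]_m)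
    (x_start : x 0%N = x0) (y_start : y 0%N = y0)
    (xy_alg : alternating_proximal L lambda mu x y) :
  ((fun k : nat => enorm (row_mx (x k) (y k))) @ \oo --> +oo) \/
  ((\sum_(1 <= k <oo)
      (enorm (x k.+1 - x k) + enorm (y k.+1 - y k))%:E < +oo)%E /\
   exists2 z : 'rV[R]_(n + m), critical_point L z &
     (fun k : nat => row_mx (x k) (y k)) @ \oo --> z).
Proof.
have [fNy gNy] := (f_proper.1, g_proper.1).
have [dQ _] := Q_C1.
have Lstart : exists u, (L (row_mx u (y 0%N)) < +oo)%E.
  by rewrite y_start; exact: Ly0_proper.2.
have rp_gt0 : 0 < rp := lt_trans rm_gt0 rm_lt_rp.
pose z := joint_iterate x y; pose d := step_length x y.
pose v k := fine (L (z k)).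
have LE k : L (z k) = (v k)%:E.
  by rewrite /v (L_iterateE HL fNy gNy Lstart xy_alg).
have zd k : `|z k.+1 - z k| <= d k by exact: joint_iterate_dist.
have d_ge0 k : 0 <= d k by exact: step_length_ge0.
have a_gt0 : 0 < (4 * rp)^-1 by rewrite invr_gt0 mulr_gt0.
have desc : forall k, v k.+1 + (4 * rp)^-1 * d k ^+ 2 <= v k.
  exact: (value_descent HL fNy gNy Lstart xy_alg rm_gt0 lambda_bounds mu_bounds).
have [c vc] : exists c : R, v @ \oo --> c.
  have [i iL] : exists i : R, (i%:E <= ereal_inf (range L))%E.
    case: (ereal_inf (range L)) infL => [t| |] // _; first by exists t.
    by exists 0; rewrite leey.
  apply/cvg_ex; apply: nonincreasing_is_cvgn.
    apply/nonincreasing_seqP => k; apply: le_trans (desc k).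
    by rewrite lerDl mulr_ge0 ?sqr_ge0 ?(ltW a_gt0).
  exists i => _ [k _ <-]; rewrite -lee_fin -LE.
  by apply: (le_trans iL); apply: ereal_inf_lbound; exists (z k).
have dcvg := descent_increment_cvg0 a_gt0 d_ge0 desc vc.
have [|/not_cvg_pinfty_freq[A freqA]] :=
    pselect ((fun k => enorm (row_mx (x k) (y k))) @ \oo --> +oo).
  by left.
right.
have [zbar zbarP] : exists zbar, cluster (z @ \oo) zbar.
  apply: (bounded_freq_cluster (A := A)) => K.
  (* [z k] is the pair of index [k.+1] *)
  have [[//|k] Kk kA] := freqA K.+1; exists k => //.
  exact: le_trans (norm_le_enorm _) (ltW kA).
have [b [w [b_gt0 wL wb]]] := iterate_subgradient HL fNy gNy Lstart xy_alg
  rm_gt0 lambda_bounds mu_bounds dQ zbar gradQ_lip.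
have Lzbar : L zbar = c%:E.
  exact: (cluster_point_value HL fNy gNy Lstart xy_alg rm_gt0 lambda_bounds
    mu_bounds dQ f_lsc g_lsc zbarP dcvg vc).
have crit : critical_point L zbar.
  exact: (cluster_point_critical zbarP zd dcvg Lzbar LE vc b_gt0 ltr01 wL wb).
have KLz : KL_property L zbar by apply: L_KL; exists 0.
have [C dC] : exists C, forall p, \sum_(k < p) d k <= C.
  apply: (KL_finite_length KLz Lzbar LE a_gt0 b_gt0 ltr01 zd desc _ zbarP vc).
  move=> k zk zk1; exists (w k); first exact: frechet_subdiff_sub.
  by apply: wb; exact: ltW.
have z_cvg := finite_length_cvg zd dC zbarP.
split; last first.
  by exists zbar => //; rewrite -cvg_shiftS.
apply: (@le_lt_trans _ _ C%:E); last exact: ltry.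
apply: lime_le.
  by apply: is_cvg_nneseries => k _ _; rewrite lee_fin addr_ge0 ?enorm_ge0.
near=> p; rewrite sumEFin lee_fin big_add1 big_mkord; exact: dC.
Unshelve. all: by end_near. Qed.
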